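(* Assume semifilter trichotomy. Then $$\mathsf{U}_{\mathrm{fin}}(\mathcal{O},\Gamma)=\mathsf{S}_{\mathrm{fin}}(\mathcal{O},\mathcal{O})\cap\mathsf{Split}(\Omega,\Lambda)$$ for arbitrary topological spaces; that is, an arbitrary topological space $X$ satisfies $\mathsf{U}_{\mathrm{fin}}(\mathcal{O},\Gamma)$ if and only if it satisfies both $\mathsf{S}_{\mathrm{fin}}(\mathcal{O},\mathcal{O})$ and $\mathsf{Split}(\Omega,\Lambda)$.
   Context: Covers. Let $\mathcal{U}$ be an open cover of a topological space $X$ (no assumption on $X$; covers are not required to be countable). $\mathcal{U}$ is large if each $x\in X$ is contained in infinitely many members of $\mathcal{U}$. $\mathcal{U}$ is an $\omega$-cover if $X\notin\mathcal{U}$ and each finite $F\subseteq X$ is contained in some $U\in\mathcal{U}$. $\mathcal{U}$ is a $\gamma$-cover if it is infinite and each $x\in X$ belongs to all but finitely many members of $\mathcal{U}$. $\mathcal{O},\Lambda,\Omega,\Gamma$ denote the collections of all open covers, large open covers, open $\omega$-covers, and open $\gamma$-covers of $X$, respectively. Properties of $X$, for families of covers $\mathscr{A},\mathscr{B}$: - $\mathsf{S}_{\mathrm{fin}}(\mathscr{A},\mathscr{B})$: for each sequence $(\mathcal{U}_n)_{n\in\mathbb{N}}$ of members of $\mathscr{A}$ there are finite $\mathcal{F}_n\subseteq\mathcal{U}_n$ with $\bigcup_n\mathcal{F}_n\in\mathscr{B}$. - $\mathsf{U}_{\mathrm{fin}}(\mathscr{A},\mathscr{B})$: for each sequence $(\mathcal{U}_n)_{n\in\mathbb{N}}$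 of members of $\mathscr{A}$ which do not contain a finite subcover, there are finite $\mathcal{F}_n\subseteq\mathcal{U}_n$ with $\{\bigcup\mathcal{F}_n : n\in\mathbb{N}\}\in\mathscr{B}$. - $\mathsf{Split}(\mathscr{A},\mathscr{B})$: every $\mathcal{U}\in\mathscr{A}$ can be split into two disjoint subcovers $\mathcal{V}$ and $\mathcal{W}$, each containing an element of $\mathscr{B}$. Semifilter trichotomy. $[\mathbb{N}]^{\aleph_0}$ is the set of infinite subsets of $\mathbb{N}=\{0,1,2,\dots\}$. For $a,b\in[\mathbb{N}]^{\aleph_0}$, $a\subseteq^* b$ means $a\setminus b$ is finite. A semifilter is a nonempty $F\subseteq[\mathbb{N}]^{\aleph_0}$ such that $a\in F$, $b\in[\mathbb{N}]^{\aleph_0}$ and $a\subseteq^* b$ imply $b\in F$. A filter is a semifilter closed under finite intersections (ultrafilters here are accordingly nonprincipal). The Fréchet filter is the set of all cofinite subsets of $\mathbb{N}$. For $a\in[\mathbb{N}]^{\aleph_0}$ and a (strictly) increasing $h\in\mathbb{N}^{\mathbb{N}}$, $a/h=\{n : a\cap[h(n),h(n+1))\neq\emptyset\}$, and $S/h=\{a/h : a\in S\}$ for $S\subseteq[\mathbb{N}]^{\aleph_0}$. Semifilter trichotomy is the statement: for each semifilter $S$ there is an increasing $h\in\mathbb{N}^{\mathbb{N}}$ such that $S/h$ is either the Fréchet filter, or an ultrafilter, or $[\mathbb{N}]^{\aleph_0}$. *)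

(* Defs.v *)
From mathcomp Require Import all_boot.
From mathcomp Require Import all_classical topology_structure.

Set Implicit Arguments.
Unset Strict Implicit.
Unset Printing Implicit Defensive.

Local Open Scope classical_set_scope.

Section Covers.
Context {X : topologicalType}.
Implicit Types (U V W F : set (set X)) (A B : set (set (set X))).

Definition covers U := cover U id = [set: X].

(* The collections O, Lambda, Omega and Gamma of covers of X. *)
Definition open_covers : set (set (set X)) :=
  [set U | (forall u, U u -> open u) /\ covers U].

Definition large_covers : set (set (set X)) :=
  [set U | open_covers U /\ forall x, infinite_set [set u | U u /\ u x]].

Definition omega_covers : set (set (set X)) :=
  [set U | [/\ open_covers U, ~ U [set: X] &
    forall K : set X, finite_set K -> exists2 u, U u & K `<=` u]].

Definition gamma_covers : set (set (set X)) :=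
  [set U | [/\ open_covers U, infinite_set U &
    forall x, finite_set [set u | U u /\ ~ u x]]].

Definition has_finite_subcover U :=
  exists F, [/\ finite_set F, F `<=` U & covers F].

End Covers.

Arguments open_covers X : clear implicits.
Arguments large_covers X : clear implicits.
Arguments omega_covers X : clear implicits.
Arguments gamma_covers X : clear implicits.

Section SelectionPrinciples.
Variable X : topologicalType.
Variables A B : set (set (set X)).

Definition S_fin := forall U : nat -> set (set X), (forall n, A (U n)) ->
  exists F : nat -> set (set X),
    (forall n, finite_set (F n) /\ F n `<=` U n) /\
    B (\bigcup_n F n).

(* The family of unions is taken as a set of sets, without multiplicities;
   in particular a gamma-cover must have infinitely many distinct unions. *)
Definition U_fin := forall U : nat -> set (set X),
  (forall n, A (U n) /\ ~ has_finite_subcover (U n)) ->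
  exists F : nat -> set (set X),
    (forall n, finite_set (F n) /\ F n `<=` U n) /\
    B [set \bigcup_(u in F n) u | n in [set: nat]].

Definition Splits := forall U : set (set X), A U ->
  exists V W : set (set X),
    [/\ V `|` W = U, V `&` W = set0, covers V, covers W &
      (exists2 V', B V' & V' `<=` V) /\ (exists2 W', B W' & W' `<=` W)].

End SelectionPrinciples.

Definition infinite_subsets : set (set nat) := [set a | infinite_set a].

Definition almost_subset (a b : set nat) := finite_set (a `\` b).

Definition semifilter (S : set (set nat)) :=
  [/\ S !=set0, S `<=` infinite_subsets &
    forall a b, S a -> infinite_subsets b -> almost_subset a b -> S b].

Definition semifilter_filter (S : set (set nat)) :=
  semifilter S /\ forall a b, S a -> S b -> S (a `&` b).

(* Nonprincipal, since every member of a semifilter is infinite. *)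
Definition semifilter_ultrafilter (S : set (set nat)) :=
  semifilter_filter S /\
  forall G, semifilter_filter G -> S `<=` G -> G = S.

Definition frechet_filter : set (set nat) := [set a | finite_set (~` a)].

Definition increasing (h : nat -> nat) := forall m n, (m < n)%N -> (h m < h n)%N.

Definition set_quo (a : set nat) (h : nat -> nat) : set nat :=
  [set n | exists2 k, a k & (h n <= k < h n.+1)%N].

Definition family_quo (S : set (set nat)) (h : nat -> nat) : set (set nat) :=
  [set set_quo a h | a in S].

Definition semifilter_trichotomy := forall S, semifilter S ->
  exists2 h, increasing h &
    [\/ family_quo S h = frechet_filter,
        semifilter_ultrafilter (family_quo S h) |
        family_quo S h = infinite_subsets].

(* Main.v *)
Require Import Defs.
From mathcomp Require Import all_boot all_classical topology_structure.
From mathcomp Require Import zify.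

(** Why the theorem holds.

Left to right.  [U_fin(O, Gamma)] contains the selection principle [S_fin(O, O)]
by forgetting that the chosen unions form a gamma-cover (a cover with a finite
subcover is trivially handled).  To split an omega-cover [U], apply the
hypothesis to the covers [W n] whose members are the intersections of at least
[n] distinct members of [U].  The selection for [W n] involves finitely many
members of [U], and almost every selection puts a given point [x] into at least
[n] of them.  Deleting fewer than [n] members of [U] therefore still leaves one
that contains [x], so the selections can be thinned out greedily to pairwise
disjoint finite blocks of [U] such that [x] is covered by almost all blocks
([omega_cover_blocks]).  The odd blocks go to one side and everything else to
the other.

Right to left.  By [S_fin(O, O)] every [U n] has a countable subcover presented
as an increasing union of finite families [E n k]; put
[V n k = \bigcap_(m <= n) \bigcup (E m k)].  A second use of [S_fin(O, O)]
([S_fin_guess]) gives a nondecreasing [f] such that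
[a x = {n | x \in V n (f n)}] is infinite for every [x].  Apply the trichotomy
to the semifilter [S] generated by the sets [a x], and let [A x = a x / h]; these
sets form a base of [S / h] modulo finite sets, and [{x | n \in A x}] is open.
- If [S / h] is the Frechet filter, every [x] satisfies
  [x \in V (h n) (f (h n.+1))] for almost all [n], which is the desired
  selection.
- If [S / h] consists of all infinite sets, [S_fin(O, O)] fails: it provides [g]
  such that every [A x] has two elements in infinitely many intervals
  [[n, g n]], whereas a set growing faster than [g] almost contains some [A x]
  ([S_fin_not_full]).
- If [S / h] is an ultrafilter, the sets [{x | n \in A x}] form an omega-cover.
  A splitting of it splits the index set, one part lies in the ultrafilter and
  almost contains some [A x], and then [x] belongs to only finitely many members
  of the other half ([split_not_ultrafilter]). *)

Set Implicit Arguments.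
Unset Strict Implicit.
Unset Printing Implicit Defensive.

Local Open Scope classical_set_scope.

(** * Finite and infinite sets of natural numbers *)

Lemma finite_set_ltn (A : set nat) :
  finite_set A <-> exists N, forall n, A n -> (n < N)%N.
Proof.
split=> [/finite_seqP[s ->]|[N AN]]; last first.
  by apply: (sub_finite_set _ (finite_II N)) => n /AN.
by exists (\max_(i <- s) i).+1 => n /= sn; rewrite ltnS; exact: leq_bigmax_seq.
Qed.

Lemma infinite_set_geq (A : set nat) :
  infinite_set A <-> forall N, exists2 n, (N <= n)%N & A n.
Proof.
rewrite finite_set_ltn; split=> [infA N|geA [N AN]].
  apply: contrapT => noA; apply: infA; exists N => n An.
  by rewrite ltnNge; apply/negP => Nn; apply: noA; exists n.
by have [n Nn /AN] := geA N; rewrite ltnNge Nn.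
Qed.

Lemma almost_subset_geq (a b : set nat) :
  almost_subset a b <-> exists N, forall n, (N <= n)%N -> a n -> b n.
Proof.
rewrite /almost_subset finite_set_ltn; split=> -[N abN]; exists N => n.
  move=> Nn an; apply: contrapT => bn.
  by have := abN n (conj an bn); rewrite ltnNge Nn.
by move=> [an bn]; rewrite ltnNge; apply/negP => Nn; apply: bn; exact: abN.
Qed.

Lemma finite_image_bounded (T : Type) (A : set T) (f : T -> nat) :
  finite_set A -> exists N, forall x, A x -> (f x <= N)%N.
Proof.
move=> /(finite_image f)/finite_set_ltn[N fN]; exists N => x Ax.
by apply/ltnW/fN; exists x.
Qed.

(** Both diagonal constructions below choose each term depending on all earlier
    ones; the finite set [A] is the set of terms chosen so far. *)
Lemma greedy_sequence (T : Type) (Q : set T) (R : T -> T -> Prop) :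
  (forall A, finite_set A -> A `<=` Q -> exists2 y, Q y & forall x, A x -> R x y) ->
  exists2 f : nat -> T, forall i, Q (f i) &
    forall i j, (i < j)%N -> R (f i) (f j).
Proof.
move=> ext.
have /choice[next nextP] : forall A, exists y, finite_set A -> A `<=` Q ->
    Q y /\ forall x, A x -> R x y.
  have [y0 _ _] := ext _ (@finite_set0 T) (@sub0set _ Q).
  move=> A; have [[fA AQ]|nA] := pselect (finite_set A /\ A `<=` Q).
    by have [y Qy Ry] := ext A fA AQ; exists y.
  by exists y0 => fA AQ; case: nA.
pose acc := fix acc n := if n is m.+1 then next (acc m) |` acc m else set0.
have accP n : finite_set (acc n) /\ acc n `<=` Q.
  elim: n => [|n [fn nQ]] /=; first by split; [exact: finite_set0 | exact: sub0set].
  have [Qy _] := nextP _ fn nQ; split; first by rewrite finite_setU.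
  by move=> x [->|/nQ].
have accS i j : (i < j)%N -> acc j (next (acc i)).
  elim: j => // j IH; rewrite ltnS leq_eqVlt => /predU1P[->|/IH ?]; first by left.
  by right.
exists (fun n => next (acc n)) => [i|i j ij].
  by have [fn nQ] := accP i; case: (nextP _ fn nQ).
by have [fn nQ] := accP j; have [_] := nextP _ fn nQ; apply; exact: accS.
Qed.

(** * From U_fin(O, Gamma) to splitting omega-covers *)

Section Selection.
Variable X : topologicalType.
Implicit Types (U V W F : set (set X)) (x : X).

Lemma coversP U : covers U <-> forall x, exists2 u, U u & u x.
Proof.
rewrite /covers; split=> [UX x|Ux].
  by have [u Uu ux] : cover U id x by [rewrite UX|]; exists u.
by apply/seteqP; split=> // x _; have [u Uu ux] := Ux x; exists u.
Qed.

(** The set of unions is infinite: every union misses a point, since no [U n] has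
    a finite subcover, and that point lies in all late unions.  If there were
    only finitely many unions, a single bound on these stages would exist, and
    the union at that bound would contain the point that it misses. *)
Lemma gamma_unions (U F : nat -> set (set X)) :
  (forall n, open_covers X (U n)) -> (forall n, ~ has_finite_subcover (U n)) ->
  (forall n, finite_set (F n) /\ F n `<=` U n) ->
  (forall x, exists N, forall n, (N <= n)%N -> (\bigcup_(u in F n) u) x) ->
  gamma_covers X [set \bigcup_(u in F n) u | n in [set: nat]].
Proof.
move=> openU nofin FU Fx; split.
- split.
    move=> _ [n _ <-]; apply: bigcup_open => u Fu.
    by have [oU _] := openU n; apply/oU/(FU n).2.
  apply/coversP => x; have [N /(_ N (leqnn N)) xN] := Fx x.
  by exists (\bigcup_(u in F N) u) => //; exists N.
- (* Each union misses a point that all late unions contain. *)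
  move=> fin.
  have /choice[M MP] : forall v : set X, exists N, v <> setT ->
      exists2 x, ~ v x & forall n, (N <= n)%N -> (\bigcup_(u in F n) u) x.
    move=> v; have [vX|/existsNP[x vx]] := pselect (forall x, v x).
      by exists 0 => /(_ _)[]; apply/seteqP; split.
    by have [N xN] := Fx x; exists N => _; exists x.
  have [N MN] := finite_image_bounded M fin.
  set v := \bigcup_(u in F N) u.
  have Nv : v <> setT.
    by move=> vT; apply: (nofin N); exists (F N); have [] := FU N.
  by have [x nvx xM] := MP v Nv; apply/nvx/xM/MN; exists N.
- move=> x; have [N xN] := Fx x.
  apply: (sub_finite_set _ (finite_image (fun n => \bigcup_(u in F n) u) (finite_II N))).
  move=> _ [[n _ <-] nx]; exists n => //=; rewrite ltnNge; apply/negP => /xN; exact: nx.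
Qed.

Lemma U_fin_S_fin : U_fin (open_covers X) (gamma_covers X) ->
  S_fin (open_covers X) (open_covers X).
Proof.
move=> Uf U oU.
have cov (F : nat -> set (set X)) : (forall n, F n `<=` U n) -> covers (\bigcup_n F n) ->
    open_covers X (\bigcup_n F n).
  by move=> FU cF; split=> // u [n _ /FU]; have [+ _] := oU n; apply.
have [[m [G [fG GU cG]]]|nofin] := pselect (exists n, has_finite_subcover (U n)).
  pose F n := if n == m then G else set0.
  have FU n : F n `<=` U n by rewrite /F; case: eqP => [->|_] //; exact: sub0set.
  exists F; split=> [n|].
    by split=> //; rewrite /F; case: ifP => _ //; exact: finite_set0.
  apply: cov => //; apply/coversP => x; have [u Gu ux] := (coversP G).1 cG x.
  by exists u => //; exists m => //; rewrite /F eqxx.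
have [n|F [FU [[_ cF] _ _]]] := Uf U.
  by split=> // nU; apply: nofin; exists n.
exists F; split=> //; apply: cov => [n|]; first by have [] := FU n.
apply/coversP => x; have [_ [n _ <-] [u Fu ux]] := (coversP _).1 cF x.
by exists u => //; exists n.
Qed.

(** An indexed form of [U_fin(O, Gamma)] without the restriction on finite
    subcovers.  For a decreasing sequence, either all the covers have finite
    subcovers or all from some point on have none; in the latter case the
    selection made for a later cover also serves for an earlier one, which
    allows passing to a subsequence. *)
Lemma U_fin_eventually (W : nat -> set (set X)) :
  U_fin (open_covers X) (gamma_covers X) ->
  (forall n, open_covers X (W n)) -> (forall n, W n.+1 `<=` W n) ->
  exists F : nat -> set (set X),
    (forall n, finite_set (F n) /\ F n `<=` W n) /\
    forall x, exists N, forall n, (N <= n)%N -> (\bigcup_(u in F n) u) x.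
Proof.
move=> Uf oW decW.
have {}decW m n : (m <= n)%N -> W n `<=` W m.
  elim: n => [|n IH]; first by rewrite leqn0 => /eqP->.
  by rewrite leq_eqVlt => /predU1P[->//|/IH mn]; exact: subset_trans mn.
have [fin|/existsNP[k nok]] := pselect (forall n, has_finite_subcover (W n)).
  have /choice[F FP] := fin; exists F; split=> [n|x].
    by have [] := FP n.
  by exists 0 => n _; have [_ _ /coversP/(_ x)[u Fu ux]] := FP n; exists u.
have [n|F [FW [_ infF Fx]]] := Uf (fun n => W (k + n)).
  split; first exact: oW.
  move=> [G [fG GW cG]]; apply: nok; exists G; split=> //.
  exact: (subset_trans GW (decW _ _ (leq_addr _ _))).
pose v n := \bigcup_(u in F n) u.
(* The gamma-cover is a set of unions: keep one index for each of infinitely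
   many distinct unions. *)
have [A fA _|f _ fR] := @greedy_sequence nat setT
    (fun i j => (i < j)%N /\ v i <> v j).
  have [N AN] := (finite_set_ltn A).1 fA.
  have /infinite_setN0[_ [[n _ <-] vn]] :=
    infinite_setD infF (finite_image v (finite_II N)).
  exists n => // i /AN iN; split; last by move=> vin; apply: vn; exists i.
  by apply: (leq_trans iN); rewrite leqNgt; apply/negP => nN; apply: vn; exists n.
have fge n : (n <= f n)%N.
  by elim: n => // n IH; have [fn _] := fR n n.+1 (leqnn _); exact: leq_ltn_trans fn.
exists (F \o f); split=> [n|x].
  have [fF FW'] := FW (f n); split=> //.
  by apply: (subset_trans FW'); apply: decW; rewrite (leq_trans (fge n)) ?leq_addl.
suff /finite_set_ltn[N xN] : finite_set [set n | ~ v (f n) x].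
  exists N => n Nn; apply: contrapT => /xN.
  by rewrite ltnNge Nn.
have injv : injective (v \o f).
  move=> i j /= vij; case: (ltngtP i j) => // ij.
    by have [_] := fR _ _ ij.
  by have [_] := fR _ _ ij; rewrite vij.
apply: sub_finite_set (finite_preimage (in2W injv) (Fx x)) => n nx /=.
by split=> //; exists (f n).
Qed.

Lemma open_seq_inter (s : seq (set X)) :
  (forall u, u \in s -> open u) -> open [set x | forall u, u \in s -> u x].
Proof.
elim: s => [|v s IH] os.
  suff -> : [set x : X | forall u : set X, u \in [::] -> u x] = setT by exact: openT.
  by apply/seteqP; split.
suff -> : [set x | forall u, u \in v :: s -> u x] =
    v `&` [set x | forall u, u \in s -> u x].
  apply: openI; first by apply: os; rewrite mem_head.
  by apply: IH => u us; apply: os; rewrite in_cons us orbT.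
apply/seteqP; split=> [x xs|x [vx xs] u]; last by rewrite in_cons => /predU1P[->//|/xs].
by split=> [|u us]; apply: xs; rewrite in_cons ?us ?orbT ?eqxx.
Qed.

(** Members of an omega-cover are proper subsets.  A member of [U] containing [x]
    and one point outside each member of [G] that lies in [U] cannot be in [G]. *)
Lemma omega_cover_avoid U G x : omega_covers X U -> finite_set G ->
  exists u, [/\ U u, u x & ~ G u].
Proof.
move=> [_ UX Uom] fG.
have /choice[p pP] : forall g : set X, exists y, U g -> ~ g y.
  move=> g; have [/existsNP[y gy]|/contrapT gX] := pselect (~ forall y, g y).
    by exists y.
  exists x => Ug; case: UX; rewrite (_ : setT = g)//.
  by apply/seteqP; split=> // y _; exact: gX.
have [|u Uu Ku] := Uom (x |` p @` G).
  by rewrite finite_setU; split=> //; exact: finite_image.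
exists u; split=> // [|Gu]; first by apply: Ku; left.
by apply: (pP u Uu); apply: Ku; right; exists u.
Qed.

Lemma omega_cover_many U n x : omega_covers X U ->
  exists s, [/\ uniq s, size s = n, [set` s] `<=` U & forall u, u \in s -> u x].
Proof.
move=> Uom; elim: n => [|n [s [us ss sU sx]]]; first by exists [::].
have [u [Uu ux su]] := omega_cover_avoid x Uom (finite_seq s).
exists (u :: s); split=> /= [||v|v].
- by rewrite us andbT; apply/negP.
- by rewrite ss.
- by rewrite /= in_cons => /predU1P[->//|/sU].
- by rewrite in_cons => /predU1P[->//|/sx].
Qed.

(** Intersections of at least [n] distinct members record multiplicity: a union
    of such intersections still covers its points by members of [U] after any
    [n - 1] members of [U] have been discarded.  This makes the blocks
    disjoint. *)
Lemma omega_cover_blocks U :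
  U_fin (open_covers X) (gamma_covers X) -> omega_covers X U ->
  exists B : nat -> set (set X),
    [/\ forall i, B i `<=` U, forall i j u, (i < j)%N -> B i u -> ~ B j u &
      forall x, exists N, forall n, (N <= n)%N -> (\bigcup_(u in B n) u) x].
Proof.
move=> Uf Uom; have [[oU _] _ _] := Uom.
pose good n (s : seq (set X)) := [/\ uniq s, (n <= size s)%N & [set` s] `<=` U].
pose inter (s : seq (set X)) := [set x | forall u, u \in s -> u x].
pose W n := [set inter s | s in good n].
have oW n : open_covers X (W n).
  split=> [_ [s [_ _ sU] <-]|]; first by apply: open_seq_inter => u /sU; exact: oU.
  apply/coversP => x; have [s [us ss sU sx]] := omega_cover_many n x Uom.
  by exists (inter s) => //; exists s => //; split=> //; rewrite ss.
have decW n : W n.+1 `<=` W n.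
  by move=> _ [s [us ss sU] <-]; exists s => //; split=> //; exact: ltnW.
have [F [FW Fx]] := U_fin_eventually Uf oW decW.
(* A pair (B, n) stands for a block B obtained from the n-th selection. *)
have [A fA AQ|f fQ fR] := @greedy_sequence (set (set X) * nat)
    [set p | [/\ finite_set p.1, p.1 `<=` U &
      \bigcup_(u in F p.2) u `<=` \bigcup_(u in p.1) u]]
    (fun p q => (p.2 < q.2)%N /\ forall u, p.1 u -> ~ q.1 u).
  have [M MA] := finite_image_bounded snd fA.
  have /finite_seqP[t tE] : finite_set (\bigcup_(p in A) p.1).
    by apply: bigcup_finite => // p /AQ[].
  pose n := maxn M.+1 (size t).+1.
  have /choice[r rP] : forall v, exists s, F n v -> good n s /\ v = inter s.
    move=> v; have [/(FW n).2[s gs <-]|nv] := pselect (F n v); last by exists [::].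
    by exists s.
  have [fF _] := FW n.
  exists ((\bigcup_(v in F n) [set` r v]) `\` [set` t], n) => /=.
    split.
    - by apply: finite_setD; apply: bigcup_finite => // v _; exact: finite_seq.
    - by move=> u [[v /rP[[_ _ rU] _] /rU]].
    - (* A point of the intersection of n sets lies in one outside t. *)
      move=> x [v Fv]; have [[ur rn rU] vE] := rP v Fv; rewrite vE => xr.
      have /existsNP[u /not_implyP[ru tu]] : ~ {subset r v <= t}.
        by move=> /(uniq_leq_size ur); rewrite leqNgt (leq_trans _ rn)// leq_maxr.
      by exists u; [split=> //; exists v|exact: xr].
  move=> p Ap; split; first by have pM : (p.2 <= M)%N := MA _ Ap; rewrite /n; lia.
  move=> u pu [_]; apply.
  by have : (\bigcup_(p in A) p.1) u; [exists p|rewrite tE].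
have fge n : (n <= (f n).2)%N.
  by elim: n => // n IH; have [fn _] := fR n n.+1 (leqnn _); exact: leq_ltn_trans fn.
exists (fun i => (f i).1); split=> [i|i j u ij|x].
- by have [] := fQ i.
- by have [_] := fR i j ij; apply.
have [N xN] := Fx x; exists N => n Nn; have [_ _] := fQ n; apply; apply: xN.
exact: leq_trans (fge n).
Qed.

Lemma blocks_infinite (B : nat -> set (set X)) x :
  (forall i j u, (i < j)%N -> B i u -> ~ B j u) ->
  (exists N, forall n, (N <= n)%N -> (\bigcup_(u in B n) u) x) ->
  infinite_set [set u | (\bigcup_n B n) u /\ u x].
Proof.
move=> disB [N xN].
have /choice[k kP] : forall u, exists n, (\bigcup_n B n) u -> B n u.
  by move=> u; have [[n _ Bu]|nu] := pselect ((\bigcup_n B n) u); [exists n|exists 0].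
move=> /(finite_image_bounded k)[M kM].
have [u Bu ux] := xN (maxn N M.+1) (leq_maxl _ _).
have kB : B (k u) u by apply: kP; exists (maxn N M.+1).
have := kM u (conj (ex_intro2 _ _ _ I Bu) ux) => kuM.
by apply: (disB _ _ u _ kB Bu); lia.
Qed.

(** Infinitely many even and infinitely many odd blocks cover a given point, and
    disjointness of the blocks makes the covering members distinct. *)
Lemma U_fin_split : U_fin (open_covers X) (gamma_covers X) ->
  Splits (omega_covers X) (large_covers X).
Proof.
move=> Uf U Uom; have [B [BU disB xB]] := omega_cover_blocks Uf Uom.
have [[oU _] _ _] := Uom.
pose C b := \bigcup_i B (2 * i + b).
have largeC b : large_covers X (C b).
  have infC x : infinite_set [set u | C b u /\ u x].
    apply: (@blocks_infinite (fun i => B (2 * i + b))) => [i j u ij|].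
      by apply: disB; lia.
    by have [N xN] := xB x; exists N => n Nn; apply: xN; lia.
  split=> //; split=> [u [i _ /BU]|]; first exact: oU.
  by apply/coversP => x; have /infinite_setN0[u []] := infC x; exists u.
have CU b : C b `<=` U by move=> u [i _ /BU].
have coverS (P Q : set (set X)) : P `<=` Q -> covers P -> covers Q.
  by move=> PQ /coversP cP; apply/coversP => x; have [u /PQ] := cP x; exists u.
have C01 u : C 0 u -> ~ C 1 u.
  move=> [i _ Bi] [j _ Bj]; case: (ltngtP (2 * i + 0) (2 * j + 1)) => ij; last lia.
    exact: (disB _ _ u ij).
  exact: (disB _ _ u ij).
have C0W : C 0 `<=` U `\` C 1 by move=> u Cu; split; [exact: CU Cu|exact: C01].
exists (U `\` C 1), (C 1); split.
- by rewrite setUC setDUK.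
- exact: setDKI.
- by apply: (coverS _ _ C0W); have [[]] := largeC 0.
- by have [[]] := largeC 1.
- by split; [exists (C 0)|exists (C 1)].
Qed.


(** * The consequence of S_fin(O, O) for increasing covers *)

Lemma open_forall_leq (P : nat -> set X) n : (forall m, open (P m)) ->
  open [set x | forall m, (m <= n)%N -> P m x].
Proof.
move=> oP; suff -> : [set x | forall m, (m <= n)%N -> P m x] =
    [set x | forall u, u \in [seq P m | m <- iota 0 n.+1] -> u x].
  by apply: open_seq_inter => _ /mapP[m _ ->].
apply/seteqP; split=> x Px => [_ /mapP[m + ->]|m mn].
  by rewrite mem_iota => mn; exact: Px.
by apply: Px; apply/map_f; rewrite mem_iota.
Qed.

(** Applying [S_fin(O, O)] to every tail [W m, W (m + 1), ...] makes the guess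
    succeed beyond every [m]; one monotone [g] dominates all the guesses because
    only finitely many tails contain a given index. *)
Lemma S_fin_guess (W : nat -> nat -> set X) :
  S_fin (open_covers X) (open_covers X) -> (forall n k, open (W n k)) ->
  (forall n k l, (k <= l)%N -> W n k `<=` W n l) ->
  (forall n x, exists k, W n k x) ->
  exists2 g : nat -> nat, {homo g : m n / (m <= n)%N} &
    forall x N, exists2 n, (N <= n)%N & W n (g n) x.
Proof.
move=> Sf oW incW Wx.
have /choice[K KP] m : exists K : nat -> nat, forall x, exists n, W (m + n) (K n) x.
  have [n|F [FW [_ /coversP cF]]] := Sf (fun n => range (W (m + n))).
    split=> [_ [k _ <-]//|]; apply/coversP => x; have [k Wk] := Wx (m + n) x.
    by exists (W (m + n) k) => //; exists k.
  have /choice[K KP] n : exists k, forall u, F n u -> u `<=` W (m + n) k.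
    have [fF FWn] := FW n.
    have /choice[r rP] : forall u, exists k, F n u -> W (m + n) k = u.
      move=> u; have [/FWn[k _ <-]|nu] := pselect (F n u); last by exists 0.
      by exists k.
    have [k rk] := finite_image_bounded r fF.
    by exists k => u Fu; rewrite -(rP u Fu); exact/incW/rk.
  by exists K => x; have [u [n _ /KP uW] /uW] := cF x; exists n.
pose g n := \max_(p : 'I_n.+1 * 'I_n.+1) K p.1 p.2.
have Kg m n : (K m n <= g (m + n))%N.
  have mle : (m < (m + n).+1)%N by lia.
  have nle : (n < (m + n).+1)%N by lia.
  exact: (@leq_bigmax _ (fun p : 'I_(m + n).+1 * 'I_(m + n).+1 => K p.1 p.2)
    (Ordinal mle, Ordinal nle)).
exists g => [m n mn|x N].
  apply/bigmax_leqP => -[i j] _ /=.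
  have mn' : (m.+1 <= n.+1)%N by [].
  exact: (@leq_bigmax _ (fun p : 'I_n.+1 * 'I_n.+1 => K p.1 p.2)
    (widen_ord mn' i, widen_ord mn' j)).
have [n nx] := KP N x; exists (N + n); first exact: leq_addr.
exact: incW nx.
Qed.

End Selection.

(** * Ultrafilters and bases modulo finite sets *)

Lemma almost_subset_infinite (a b : set nat) :
  infinite_set a -> almost_subset a b -> infinite_set b.
Proof.
move=> /infinite_set_geq infa /almost_subset_geq[N abN]; apply/infinite_set_geq => M.
have [n nMN an] := infa (maxn N M).
by exists n; [lia|apply: abN => //; lia].
Qed.

(** If [a] meets all members of [p] in infinite sets, then [a] and [p] generate a
    semifilter that is a filter, and maximality puts [a] into [p].  Otherwise
    some member of [p] is almost contained in the complement of [a]. *)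
Lemma ultrafilter_setC (p : set (set nat)) (a : set nat) :
  semifilter_ultrafilter p -> p a \/ p (~` a).
Proof.
move=> [[[[b0 pb0] pinf pup] pI] pmax].
have [meets|/existsNP[b /not_implyP[pb /contrapT fab]]] :=
    pselect (forall b, p b -> infinite_set (a `&` b)); last first.
  have bCa : almost_subset b (~` a).
    by apply: sub_finite_set fab => n [bn /contrapT an].
  by right; apply: (pup b) => //; apply: almost_subset_infinite bCa; exact: pinf.
left; pose G := [set c : set nat | infinite_set c /\
  exists2 b, p b & almost_subset (a `&` b) c].
have upG c : (exists2 b, p b & almost_subset (a `&` b) c) -> G c.
  by move=> [b pb abc]; split; [apply: almost_subset_infinite abc; exact: meets|exists b].
have subG b c : p b -> a `&` b `<=` c -> G c.
  move=> pb abc; apply: upG; exists b => //; apply/almost_subset_geq.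
  by exists 0 => n _; exact: abc.
suff -> : p = G by apply: (subG b0) => // n [].
apply/esym/pmax; last by move=> b pb; apply: (subG b) => // n [].
split; first split.
- by exists a; apply: (subG b0) => // n [].
- by move=> c [].
- move=> c d [_ [b pb /almost_subset_geq[N abc]]] infd /almost_subset_geq[M cd].
  split=> //; exists b => //; apply/almost_subset_geq; exists (maxn N M) => n nNM ab.
  by apply: cd; [lia|apply: abc => //; lia].
- move=> c d [_ [b pb /almost_subset_geq[N abc]]] [_ [b' pb' /almost_subset_geq[M abd]]].
  apply: upG; exists (b `&` b'); first exact: pI.
  apply/almost_subset_geq; exists (maxn N M) => n nNM [an [bn b'n]].
  by split; [apply: abc|apply: abd] => //; lia.
Qed.

Definition almost_base (I : Type) (A : I -> set nat) (S : set (set nat)) :=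
  (forall i, S (A i)) /\ forall b, S b -> exists i, almost_subset (A i) b.

Lemma increasing_geq (h : nat -> nat) n : increasing h -> (n <= h n)%N.
Proof. by move=> hh; elim: n => // n IH; exact: leq_ltn_trans (hh _ _ (ltnSn n)). Qed.

Lemma almost_base_quo (I : Type) (A : I -> set nat) S h : increasing h ->
  almost_base A S -> almost_base (fun i => set_quo (A i) h) (family_quo S h).
Proof.
move=> hh [SA AS]; split=> [i|_ [c /AS[i /almost_subset_geq[N Ac]] <-]].
  by exists (A i).
exists i; apply/almost_subset_geq; exists N => n Nn [k Ak hk]; exists k => //.
by apply: Ac => //; have := increasing_geq n hh; lia.
Qed.

(** * Excluding the full family and ultrafilters *)

Section SetValued.
Variables (X : topologicalType) (A : X -> set nat).
Hypothesis openA : forall n, open [set x | A x n].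

Lemma open_set_quo h n : open [set x | set_quo (A x) h n].
Proof.
suff -> : [set x | set_quo (A x) h n] =
    \bigcup_(k in [set k | (h n <= k < h n.+1)%N]) [set x | A x k].
  by apply: bigcup_open.
by apply/seteqP; split=> x [k]; exists k.
Qed.

(** Diagonalization against the guessing function: some [g] puts two elements of
    each [A x] into infinitely many intervals [[n, g n]], and a set that leaves
    gaps larger than [g] cannot almost contain such an [A x]. *)
Lemma S_fin_not_full : S_fin (open_covers X) (open_covers X) ->
  ~ almost_base A infinite_subsets.
Proof.
move=> Sf [infA baseA].
(* Asking for a single element of A x in [n, k] would not be enough, since a
   sparse set may still meet infinitely many intervals [n, g n]. *)
pose W n k := \bigcup_(p in [set p : nat * nat | (n <= p.1 < p.2)%N && (p.2 <= k)%N])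
  ([set x | A x p.1] `&` [set x | A x p.2]).
have [n k|n k l kl x [p /= np Ap]|n x|g gmono gW] := S_fin_guess (W := W) Sf.
- by apply: bigcup_open => p _; exact: openI.
- by exists p => //=; lia.
- have /infinite_set_geq infx := infA x.
  have [i ni Ai] := infx n; have [j ij Aj] := infx i.+1.
  by exists j, (i, j) => //=; lia.
(* Each interval [n, g n] contains at most one value of a. *)
pose a i := iter i (fun m => (g m + m).+1) 0.
have aS i : a i.+1 = (g (a i) + a i).+1 by [].
have amono i j : (i <= j)%N -> (a i <= a j)%N.
  elim: j => [|j IH]; first by rewrite leqn0 => /eqP->.
  rewrite leq_eqVlt => /predU1P[->//|/IH]; rewrite aS; lia.
have age i : (i <= a i)%N by elim: i => // i IH; rewrite aS; lia.
have [|x /almost_subset_geq[N Aa]] := baseA (range a).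
  by apply/infinite_set_geq => N; exists (a N) => //; exists N.
have [n Nn [[i j] /= nij [Ai Aj]]] := gW x N.
have [s _ si] : range a i by apply: Aa => //; lia.
have [t _ tj] : range a j by apply: Aa => //; lia.
have st : (s < t)%N by rewrite ltnNge; apply/negP => /amono; lia.
have := amono _ _ st; rewrite aS si tj; have := gmono n i; lia.
Qed.

(** The sets [{x | n \in A x}] form an omega-cover because a finite intersection
    of sets [A x] is in [p], hence nonempty. *)
Lemma split_not_ultrafilter p : Splits (omega_covers X) (large_covers X) ->
  (forall n, [set x | A x n] <> [set: X]) -> almost_base A p ->
  ~ semifilter_ultrafilter p.
Proof.
move=> spl ApropX [pA baseA] ultra.
have [[[[b0 pb0] pinf pup] pI] _] := ultra.
pose O n := [set x | A x n].
have omega (K : set X) : finite_set K -> exists2 u, range O u & K `<=` u.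
  move=> /finite_seqP[s ->].
  suff ps : p [set n | forall x, x \in s -> A x n].
    have /infinite_setN0[n nA] := pinf _ ps.
    by exists (O n) => [|x /=]; [exists n|exact: nA].
  elim: s => [|y s IH].
    apply: (pup _ _ pb0); last by apply/almost_subset_geq; exists 0.
    by apply/infinite_set_geq => N; exists N.
  suff -> : [set n | forall x, x \in y :: s -> A x n] =
    A y `&` [set n | forall x, x \in s -> A x n] by exact: pI.
  apply/seteqP; split=> [n yn|n [Ay An] x]; last by rewrite in_cons => /predU1P[->//|/An].
  by split=> [|x xs]; apply: yn; rewrite in_cons ?xs ?orbT ?eqxx.
have [|V [W [VWO VW0 _ _ [[V' largeV V'V] [W' largeW W'W]]]]] := spl (range O).
  split=> //; last by move=> [n _ /ApropX].
  split=> [_ [n _ <-]|]; first exact: openA.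
  apply/coversP => x.
  by have [u Ou xu] := omega [set x] (finite_set1 x); exists u => //; exact: xu.
(* If the index set of P were in p, it would almost contain some A x, and x would
   lie in only finitely many members of the disjoint family Q. *)
have key (P Q : set (set X)) : P `&` Q = set0 -> (exists2 Q', large_covers X Q' & Q' `<=` Q) ->
    Q `<=` range O -> ~ p [set n | P (O n)].
  move=> PQ0 [Q' [_ largeQ] Q'Q] QO /baseA[x /almost_subset_geq[N AN]].
  apply: (largeQ x); apply: (sub_finite_set _ (finite_image O (finite_II N))).
  move=> u [/Q'Q Qu ux]; have [n _ On] := QO u Qu; exists n => //=.
  rewrite ltnNge; apply/negP => Nn; suff : (P `&` Q) u by rewrite PQ0.
  by split=> //; rewrite -On; apply: AN => //; move: ux; rewrite -On.
have [] := ultrafilter_setC [set n | V (O n)] ultra.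
  by apply: (key V W) => //; [exists W'|rewrite -VWO => u; right].
suff -> : ~` [set n | V (O n)] = [set n | W (O n)].
  by apply: (key W V); [rewrite setIC|exists V'|rewrite -VWO => u; left].
apply/seteqP; split=> n => [Vn|Wn Vn].
  by have : range O (O n) by [exists n]; rewrite -VWO => -[].
by have : (V `&` W) (O n) by []; rewrite VW0.
Qed.

End SetValued.

(** * The equivalence under semifilter trichotomy *)

Theorem theorem5p1 (trichotomy : semifilter_trichotomy) (X : topologicalType) :
  U_fin (open_covers X) (gamma_covers X) <->
  S_fin (open_covers X) (open_covers X) /\
  Splits (omega_covers X) (large_covers X).
Proof.
split=> [Uf|[Sf spl] U UP].
  by split; [exact: U_fin_S_fin|exact: U_fin_split].
have oU n : open_covers X (U n) by have [] := UP n.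
have nofin n : ~ has_finite_subcover (U n) by have [] := UP n.
have [[x0 _]|X0] := pselect (exists x : X, True); last first.
  case: (nofin 0); exists set0; split; [exact: finite_set0|exact: sub0set|].
  by apply/coversP => x; case: X0; exists x.
have /choice[F FP] n : exists F : nat -> set (set X),
    (forall i, finite_set (F i) /\ F i `<=` U n) /\ open_covers X (\bigcup_i F i).
  exact: Sf.
pose E n k := \bigcup_(i in [set i | (i <= k)%N]) F n i.
have EP n k : finite_set (E n k) /\ E n k `<=` U n.
  have [Fn _] := FP n; split; last by move=> u [i _ /(Fn i).2].
  apply: bigcup_finite => [|i _]; last by have [] := Fn i.
  exact: (sub_finite_set _ (finite_II k.+1)).
pose T n k := \bigcup_(u in E n k) u.
have oT n k : open (T n k).
  by apply: bigcup_open => u /(EP n k).2; have [+ _] := oU n; apply.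
have incT n k l : (k <= l)%N -> T n k `<=` T n l.
  by move=> kl x [u [i ik Fu] ux]; exists u => //; exists i => //=; exact: leq_trans kl.
have coverT n x : exists k, T n k x.
  have [_ [_ /coversP/(_ x)[u [i _ Fu] ux]]] := FP n.
  by exists i, u => //; exists i => /=.
have TproperX n k : T n k <> [set: X].
  by move=> TX; apply: (nofin n); exists (E n k); have [] := EP n k.
pose V n k := [set x | forall m, (m <= n)%N -> T m k x].
have oV n k : open (V n k) by apply: (open_forall_leq (P := T ^~ k)) => m.
have decV m n k l : (m <= n)%N -> (k <= l)%N -> V n k `<=` V m l.
  by move=> mn kl x nx i im; apply: (incT _ _ _ kl); apply: nx; exact: leq_trans mn.
have coverV n x : exists k, V n k x.
  elim: n => [|n [k kx]].
    by have [k kx] := coverT 0 x; exists k => m; rewrite leqn0 => /eqP->.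
  have [l lx] := coverT n.+1 x; exists (maxn k l) => m.
  rewrite leq_eqVlt => /predU1P[->|mn].
    by apply: incT lx; exact: leq_maxr.
  by apply: incT (kx m mn); exact: leq_maxl.
have [f fmono fV] : exists2 f : nat -> nat, {homo f : m n / (m <= n)%N} &
    forall x N, exists2 n, (N <= n)%N & V n (f n) x.
  by apply: S_fin_guess => // n k l; exact: decV.
pose a x := [set n | V n (f n) x].
have infa x : infinite_set (a x) by apply/infinite_set_geq => N; exact: fV.
pose S := [set b : set nat | infinite_set b /\ exists x, almost_subset (a x) b].
have aS : almost_base a S.
  split=> [x|b []//]; split=> //; exists x; apply/almost_subset_geq.
  by exists 0.
have semiS : semifilter S.
  split=> [|b []//|b c [_ [x /almost_subset_geq[N xb]]] infc /almost_subset_geq[M bc]].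
    by exists (a x0); have [] := aS.
  split=> //; exists x; apply/almost_subset_geq; exists (maxn N M) => n nNM an.
  by apply: bc; [lia|apply: xb => //; lia].
have [h hh tri] := trichotomy S semiS.
have ah := almost_base_quo hh aS.
have quoV n x : set_quo (a x) h n -> V (h n) (f (h n.+1)) x.
  by move=> [k ak hk]; apply: decV ak; [|apply: fmono]; lia.
have openq n : open [set x | set_quo (a x) h n].
  by apply: open_set_quo => m; exact: oV.
case: tri => [frechet|ultra|full].
(* Since n <= h n, membership in V (h n) (f (h n.+1)) controls the n-th cover. *)
- exists (fun n => E n (f (h n.+1))); split=> //; apply: gamma_unions => // x.
  have [/(_ x)] := ah; rewrite frechet => /finite_set_ltn[N xN].
  move=> _; exists N => n Nn; apply: (quoV n x _ n (increasing_geq n hh)).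
  by apply: contrapT => /xN; rewrite ltnNge Nn.
- exfalso; apply: (split_not_ultrafilter openq spl _ ah ultra) => n qX.
  apply: (TproperX (h n) (f (h n.+1))); apply/seteqP; split=> // x _.
  suff /quoV : set_quo (a x) h n by apply.
  by have : [set: X] x by []; rewrite -qX.
- by exfalso; apply: (S_fin_not_full openq Sf); rewrite -full.
Qed.
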